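(* Let $(\mathcal{A},\cdot,\alpha)$ be a commutative Hom-associative superalgebra with an even derivation $D$ such that $\alpha D=D\alpha$, and let $\lambda$ be a fixed complex number. Define, for all homogeneous $x,y\in\mathcal{A}$, $$x\circ y=x\cdot D(y)+\lambda\, x\cdot y,\qquad [x,y]^-=x\cdot D(y)-(-1)^{|x||y|}y\cdot D(x).$$ Then $(\mathcal{A},[\cdot,\cdot]^-,\circ,\alpha)$ is a super Hom-Gel'fand-Dorfman bialgebra.
   Context: All linear spaces are over $\mathbb{C}$. A superspace is a $\mathbb{Z}_2$-graded linear space $\mathcal{A}=\mathcal{A}_0\oplus\mathcal{A}_1$; $|x|\in\{0,1\}$ is the parity of a homogeneous element $x$. Formulas containing $|x|$ are stated for homogeneous elements and extended by linearity. Hom-associative superalgebra $(\mathcal{A},\cdot,\alpha)$: a superspace with an even bilinear product $\cdot$ and an even linear map $\alpha:\mathcal{A}\to\mathcal{A}$ such that $\alpha(x)\cdot(y\cdot z)=(x\cdot y)\cdot\alpha(z)$ for all $x,y,z$. It is commutative if $x\cdot y=(-1)^{|x||y|}y\cdot x$ for all homogeneous $x,y$. An even derivation is an even linear map $D:\mathcal{A}\to\mathcal{A}$ with $D(x\cdot y)=D(x)\cdot y+x\cdot D(y)$. Hom-Lie superalgebra $(\mathcal{A},[\cdot,\cdot],\alpha)$: a superspace with an even bilinear map $[\cdot,\cdot]:\mathcal{A}\times\mathcal{A}\to\mathcal{A}$ and an even linear map $\alpha:\mathcal{A}\to\mathcal{A}$ such that for all homogeneous $x,y,z$: $[x,y]=-(-1)^{|x||y|}[y,x]$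 and $(-1)^{|x||z|}[[x,y],\alpha(z)]+(-1)^{|x||y|}[[y,z],\alpha(x)]+(-1)^{|y||z|}[[z,x],\alpha(y)]=0$. Hom-Novikov superalgebra $(\mathcal{A},\circ,\alpha)$: a superspace with an even bilinear operation $\circ$ and an even linear map $\alpha$ such that for all homogeneous $x,y,z$: $(x\circ y)\circ\alpha(z)-\alpha(x)\circ(y\circ z)=(-1)^{|x||y|}\big((y\circ x)\circ\alpha(z)-\alpha(y)\circ(x\circ z)\big)$ and $(x\circ y)\circ\alpha(z)=(-1)^{|y||z|}(x\circ z)\circ\alpha(y)$. Super Hom-Gel'fand-Dorfman bialgebra $(\mathcal{A},[\cdot,\cdot],\circ,\alpha)$: a superspace with an even linear map $\alpha$ and two operations such that $(\mathcal{A},[\cdot,\cdot],\alpha)$ is a Hom-Lie superalgebra, $(\mathcal{A},\circ,\alpha)$ is a Hom-Novikov superalgebra, and for all homogeneous $x,y,z$: $[x\circ y,\alpha(z)]-(-1)^{|y||z|}[x\circ z,\alpha(y)]+[x,y]\circ\alpha(z)-(-1)^{|y||z|}[x,z]\circ\alpha(y)-\alpha(x)\circ[y,z]=0$. *)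

(* Defs.v *)
From HB Require Import structures.
From mathcomp Require Import all_boot all_order all_algebra.
From mathcomp Require Import sesquilinear.

Set Implicit Arguments.
Unset Strict Implicit.
Unset Printing Implicit Defensive.

Import GRing.Theory.
Local Open Scope ring_scope.

(* A parity is a [bool]: [false] is 0 and [true] is 1, so that [addb] is addition
   in Z/2 and [i && j] is the product [i * j]. The projections [component] onto
   the two summands are determined by [homog], and [x \in homog i] is equivalent
   to [component i x = x], so requiring [homog i] to be boolean loses nothing. *)
Record superspace (K : fieldType) := Superspace {
  supersort :> lmodType K;
  homog : bool -> {pred supersort};
  component : bool -> supersort -> supersort;
  homog_closed : forall i, submod_closed (homog i);
  component_homog : forall i x, component i x \in homog i;
  component_sum : forall x, x = component false x + component true x;
  homog_direct :
    forall x, x \in homog false -> x \in homog true -> x = 0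
}.

Arguments homog {K} _ i _.
Arguments component {K s} i _.
Arguments homog_closed {K} _ i.

(* The Koszul sign (-1)^(|x||y|) for [|x| = i] and [|y| = j]. *)
Definition ksign (K : fieldType) (i j : bool) : K := (-1) ^+ (i && j).

Section Superalgebras.
Variables (K : fieldType) (A : superspace K).
Implicit Types (op : A -> A -> A) (f : A -> A).

Definition even_linear f : Prop :=
  linear f /\ (forall i x, x \in homog A i -> f x \in homog A i).

Definition even_bilinear op : Prop :=
  bilinear_for *:%R *:%R op /\
  (forall i j x y, x \in homog A i -> y \in homog A j ->
     op x y \in homog A (i (+) j)).

Record hom_associative_superalgebra (mul : A -> A -> A) (alpha : A -> A) : Prop :=
  HomAssociativeSuperalgebra {
    hom_assoc_mul_even : even_bilinear mul;
    hom_assoc_alpha_even : even_linear alpha;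
    hom_associativity : forall x y z,
      mul (alpha x) (mul y z) = mul (mul x y) (alpha z)
  }.

Definition supercommutative (mul : A -> A -> A) : Prop :=
  forall i j x y, x \in homog A i -> y \in homog A j ->
    mul x y = ksign K i j *: mul y x.

Definition even_derivation (mul : A -> A -> A) (D : A -> A) : Prop :=
  even_linear D /\ (forall x y, D (mul x y) = mul (D x) y + mul x (D y)).

Record hom_Lie_superalgebra (brk : A -> A -> A) (alpha : A -> A) : Prop :=
  HomLieSuperalgebra {
    hom_Lie_brk_even : even_bilinear brk;
    hom_Lie_alpha_even : even_linear alpha;
    hom_Lie_skew : forall i j x y, x \in homog A i -> y \in homog A j ->
      brk x y = - (ksign K i j *: brk y x);
    hom_Lie_Jacobi : forall i j k x y z,
      x \in homog A i -> y \in homog A j -> z \in homog A k ->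
      ksign K i k *: brk (brk x y) (alpha z)
      + ksign K i j *: brk (brk y z) (alpha x)
      + ksign K j k *: brk (brk z x) (alpha y) = 0
  }.

Record hom_Novikov_superalgebra (circ : A -> A -> A) (alpha : A -> A) : Prop :=
  HomNovikovSuperalgebra {
    hom_Novikov_circ_even : even_bilinear circ;
    hom_Novikov_alpha_even : even_linear alpha;
    hom_Novikov_left_symmetry : forall i j k x y z,
      x \in homog A i -> y \in homog A j -> z \in homog A k ->
      circ (circ x y) (alpha z) - circ (alpha x) (circ y z)
      = ksign K i j *:
          (circ (circ y x) (alpha z) - circ (alpha y) (circ x z));
    hom_Novikov_right_commutativity : forall i j k x y z,
      x \in homog A i -> y \in homog A j -> z \in homog A k ->
      circ (circ x y) (alpha z) = ksign K j k *: circ (circ x z) (alpha y)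
  }.

Record super_hom_Gelfand_Dorfman_bialgebra
    (brk circ : A -> A -> A) (alpha : A -> A) : Prop :=
  SuperHomGelfandDorfmanBialgebra {
    hom_GD_Lie : hom_Lie_superalgebra brk alpha;
    hom_GD_Novikov : hom_Novikov_superalgebra circ alpha;
    hom_GD_compat : forall i j k x y z,
      x \in homog A i -> y \in homog A j -> z \in homog A k ->
      brk (circ x y) (alpha z) - ksign K j k *: brk (circ x z) (alpha y)
      + circ (brk x y) (alpha z) - ksign K j k *: circ (brk x z) (alpha y)
      - circ (alpha x) (brk y z) = 0
  }.

(* The formula involves no sign, so it is the same on all elements. *)
Definition deriv_circ (mul : A -> A -> A) (D : A -> A) (lambda : K) (x y : A) : A :=
  mul x (D y) + lambda *: mul x y.

(* x D(y) - (-1)^(|x||y|) y D(x), extended bilinearly from homogeneous elements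
   by summing over the components of [x] and [y]; see [deriv_bracket_homog]. *)
Definition deriv_bracket (mul : A -> A -> A) (D : A -> A) (x y : A) : A :=
  \sum_(i : bool) \sum_(j : bool)
    (mul (component i x) (D (component j y))
     - ksign K i j *: mul (component j y) (D (component i x))).

Lemma component_id i (x : A) : x \in homog A i -> component i x = x.
Proof.
have sub k u v : u \in homog A k -> v \in homog A k -> u - v \in homog A k.
  move=> hu hv; have [_ cl] := homog_closed A k.
  by rewrite addrC -scaleN1r; apply: cl.
move=> hx; have sx := component_sum x; have hc k := component_homog k x.
apply/esym/eqP; rewrite -subr_eq0; apply/eqP.
case: i hx => hx; apply: homog_direct; first 1 last.
- exact: sub.
- exact: sub.
- by rewrite {1}sx addrC addKr.
- by rewrite {1}sx addrK.
Qed.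

Lemma component_neq i (x : A) : x \in homog A i -> component (~~ i) x = 0.
Proof.
move=> hx; have sx := component_sum x; have ex := component_id hx.
case: i hx ex => hx ex; rewrite ex in sx; apply: (addrI x); rewrite addr0 /=.
  by rewrite addrC -sx.
by rewrite -sx.
Qed.

Lemma deriv_bracket_homog mul D i j x y :
  even_bilinear mul -> even_linear D ->
  x \in homog A i -> y \in homog A j ->
  deriv_bracket mul D x y = mul x (D y) - ksign K i j *: mul y (D x).
Proof.
move=> [[mull mulr] _] [Dl _] hx hy.
have D0 : D 0 = 0 by have := Dl (-1) 0 0; rewrite !scaleN1r oppr0 addr0 addNr.
have m0l z : mul 0 z = 0.
  by have := mull z (-1) 0 0; rewrite /= !scaleN1r oppr0 addr0 addNr.
have m0r z : mul z 0 = 0.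
  by have := mulr z (-1) 0 0; rewrite /= !scaleN1r oppr0 addr0 addNr.
rewrite /deriv_bracket (bigD1 i) //= (bigD1 j) //= !component_id //.
rewrite big1 => [|k nk]; last first.
  have -> : k = ~~ j by case: k j nk {hy} => [] [].
  by rewrite (component_neq hy) D0 m0r m0l scaler0 subr0.
rewrite big1 => [|k nk]; first by rewrite !addr0.
have -> : k = ~~ i by case: k i nk {hx} => [] [].
by rewrite (component_neq hx) big1 // => l _; rewrite D0 m0r m0l scaler0 subr0.
Qed.

End Superalgebras.

(* Main.v *)
Require Import Defs.
From HB Require Import structures.
From mathcomp Require Import all_boot all_order all_algebra.
From mathcomp Require Import boolp reals complex.
From mathcomp Require Import sesquilinear ring zify.

Local Open Scope ring_scope.

(* Put M(x, y, z) = (x y) alpha(z). Hom-associativity and supercommutativity make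
   M symmetric up to Koszul signs, and every double product of the theorem is a
   combination of terms M(D^p x, D^q y, D^r z). Replacing such a term by the
   monomial X^p Y^q Z^r, the product x o y gets the symbol Y + lambda, the bracket
   gets Y - X, and D applied to x y gets X + Y. Permuting x, y, z permutes the
   variables and produces exactly the sign written in each axiom, so the axioms
   become identities between commutative polynomials; for instance the Jacobi
   identity is the vanishing of the cyclic sum of (Y - X) (Z - X - Y). *)

Import GRing.Theory.

Section DerivationCalculus.
Set Implicit Arguments.
Unset Strict Implicit.
Variables (K : fieldType) (A : superspace K).
Variables (mul : A -> A -> A) (alpha D : A -> A).
Hypotheses (hA : hom_associative_superalgebra mul alpha)
  (hcomm : supercommutative mul) (hD : even_derivation mul D)
  (halphaD : forall x : A, alpha (D x) = D (alpha x)).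

Let mul_bilinear := proj1 (hom_assoc_mul_even hA).
HB.instance Definition _ := bilinear_isBilinear.Build K A A A *:%R *:%R mul
  mul_bilinear.
HB.instance Definition _ := GRing.isLinear.Build K A A *:%R D
  (proj1 (proj1 hD)).
HB.instance Definition _ := GRing.isLinear.Build K A A *:%R alpha
  (proj1 (hom_assoc_alpha_even hA)).

Let DD u v : D (u + v) = D u + D v. Proof. exact: linearD. Qed.
Let DZ c u : D (c *: u) = c *: D u. Proof. exact: linearZ. Qed.
(* The generic linearZ would also match a *: (b *: x), hence DZ. *)
Let expandE := (linearDl, linearDr, linearZl_LR, linearZr_LR, DD, DZ).

Lemma ksignC i j : ksign K i j = ksign K j i.
Proof. by rewrite /ksign andbC. Qed.

Lemma ksignK i j : ksign K i j * ksign K i j = 1.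
Proof. by rewrite -expr2 sqrr_sign. Qed.

Lemma ksignZK i j t (v : A) :
  ksign K i j *: (t *: (ksign K i j *: v)) = t *: v.
Proof. by rewrite !scalerA mulrAC ksignK mul1r. Qed.

Lemma iter_homog n i x : x \in homog A i -> iter n D x \in homog A i.
Proof. by move=> hx; elim: n => //= n; apply: (proj2 (proj1 hD)). Qed.

(** The operation with symbol aX + bY + c. It covers both operations of the theorem, so each double
    product needs only one symbol computation. *)
Definition deriv_op (a b c : K) (x y : A) : A :=
  a *: mul (D x) y + b *: mul x (D y) + c *: mul x y.

Lemma deriv_circE lambda x y :
  deriv_circ mul D lambda x y = deriv_op 0 1 lambda x y.
Proof. by rewrite /deriv_op scale0r add0r scale1r. Qed.

Lemma deriv_op_even a b c : even_bilinear (deriv_op a b c).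
Proof.
split; first split.
- move=> y k x x' /=; rewrite /deriv_op !expandE /= !scalerDr !scalerA.
  by rewrite ![k * _]mulrC [RHS]addrACA [X in _ = X + _]addrACA.
- move=> x k y y' /=; rewrite /deriv_op !expandE /= !scalerDr !scalerA.
  by rewrite ![k * _]mulrC [RHS]addrACA [X in _ = X + _]addrACA.
move=> i j x y hx hy; have [_ cl] := homog_closed A (i (+) j).
have h0 : (0 : A) \in homog A (i (+) j) by case: (homog_closed A (i (+) j)).
have [_ hm] := hom_assoc_mul_even hA; have [[_ hDh] _] := hD.
rewrite /deriv_op -addrA; apply: (cl); first by apply: hm => //; apply: hDh.
apply: (cl); first by apply: hm => //; apply: hDh.
by rewrite -[_ *: _]addr0; apply: (cl) => //; apply: hm.
Qed.

(** On homogeneous components supercommutativity absorbs the Koszul sign into D(x) y. What remains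
    is sign-free and bilinear, so the sum over components collapses. *)
Lemma deriv_bracketE x y : deriv_bracket mul D x y = deriv_op (-1) 1 0 x y.
Proof.
set f := deriv_op _ _ _.
have [[fl fr] _] : even_bilinear f by apply: deriv_op_even.
have fDl u v w : f (u + v) w = f u w + f v w.
  by have := fl w 1 u v; rewrite /= !scale1r.
have fDr u v w : f u (v + w) = f u v + f u w.
  by have := fr u 1 v w; rewrite /= !scale1r.
have comm i j : mul (component i x) (D (component j y))
    - ksign K i j *: mul (component j y) (D (component i x))
    = f (component i x) (component j y).
  rewrite -hcomm ?component_homog // ?(proj2 (proj1 hD)) ?component_homog //.
  by rewrite /f /deriv_op scaleN1r scale1r scale0r addr0 addrC.
rewrite /deriv_bracket !big_bool /= !comm.
rewrite [in RHS](component_sum x) [in RHS](component_sum y) fDl !fDr.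
by rewrite addrC [X in X + _]addrC [X in _ + X]addrC.
Qed.

Definition deriv_monomial x y z p q r : A :=
  mul (mul (iter p D x) (iter q D y)) (alpha (iter r D z)).

Definition monomial3 (X Y Z : {poly K}) (p q r : nat) :=
  X ^+ p * Y ^+ q * Z ^+ r.

(* Only exponents below 3 occur, which allows the Kronecker substitution
   X = T, Y = T^3, Z = T^9 in a single indeterminate T. *)
Definition symbol_map x y z (X Y Z : {poly K}) (phi : {linear {poly K} -> A}) :=
  forall p q r, (p < 3)%N -> (q < 3)%N -> (r < 3)%N ->
    phi (monomial3 X Y Z p q r) = deriv_monomial x y z p q r.

Lemma symbol_map_exists x y z : exists X Y Z phi, symbol_map x y z X Y Z phi.
Proof.
(* The base 3 digits of i recover (p, q, r) from i = p + 3q + 9r; coefficients of degree 27 and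
   above are discarded. *)
pose f (P : {poly K}) : A :=
  \sum_(i < 27) P`_i *: deriv_monomial x y z (i %% 3) (i %/ 3 %% 3) (i %/ 9).
have flin : linear f.
  move=> c P Q; rewrite /f scaler_sumr -big_split /=; apply: eq_bigr => i _.
  by rewrite coefD coefZ scalerDl scalerA.
pose phi := HB.pack_for {linear {poly K} -> A} f
  (GRing.isLinear.Build K {poly K} A *:%R f flin).
exists 'X, 'X^3, 'X^9, phi => p q r hp hq hr; rewrite /monomial3 /=.
have hi : (p + 3 * q + 9 * r < 27)%N by lia.
rewrite -!exprM -!exprD /f (bigD1 (Ordinal hi)) //= coefXn eqxx scale1r.
rewrite big1 ?addr0 => [|i ni]; last first.
  by rewrite coefXn -val_eqE in ni *; rewrite (negPf ni) scale0r.
by congr (deriv_monomial _ _ _ _ _ _); lia.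
Qed.

Section Symbols.
Variables (x y z : A) (X Y Z : {poly K}) (phi : {linear {poly K} -> A}).
Hypothesis hphi : symbol_map x y z X Y Z phi.

Local Notation m := (monomial3 X Y Z).

Let phiD P Q : phi (P + Q) = phi P + phi Q. Proof. exact: linearD. Qed.
Let phiZ c P : phi (c *: P) = c *: phi P. Proof. exact: linearZ. Qed.

(** Since D is even, one sign serves all exponents p and q, and it can be carried by the map
    itself. *)
Lemma symbol_map_swapl i j : x \in homog A i -> y \in homog A j ->
  symbol_map y x z Y X Z (ksign K i j \*: phi).
Proof.
move=> hx hy p q r hp hq hr; rewrite /= /monomial3 [Y ^+ p * _]mulrC -/(m q p r).
rewrite hphi // /deriv_monomial.
by rewrite (hcomm (iter_homog p hy) (iter_homog q hx)) ksignC expandE.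
Qed.

(** Hom-associativity rebrackets to alpha(x) (y z), where supercommutativity exchanges the last two
    factors. *)
Lemma symbol_map_swapr j k : y \in homog A j -> z \in homog A k ->
  symbol_map x z y X Z Y (ksign K j k \*: phi).
Proof.
move=> hy hz p q r hp hq hr; rewrite /= /monomial3 mulrAC -/(m p r q).
rewrite hphi // /deriv_monomial -!(hom_associativity hA).
by rewrite (hcomm (iter_homog q hz) (iter_homog r hy)) ksignC expandE.
Qed.

Lemma deriv_op_opl a b c a' b' c' :
  deriv_op a b c (deriv_op a' b' c' x y) (alpha z)
  = phi ((a%:P * (X + Y) + b%:P * Z + c%:P) * (a'%:P * X + b'%:P * Y + c'%:P)).
Proof.
(* The symbol is expanded into monomials with exponents at most 2, the range in which [hphi]
   applies; the factor X + Y comes from the Leibniz rule. *)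
transitivity (phi (
    a *: (a' *: (m 2 0 0 + m 1 1 0) + b' *: (m 1 1 0 + m 0 2 0)
          + c' *: (m 1 0 0 + m 0 1 0))
    + b *: (a' *: m 1 0 1 + b' *: m 0 1 1 + c' *: m 0 0 1)
    + c *: (a' *: m 1 0 0 + b' *: m 0 1 0 + c' *: m 0 0 0))); last first.
  by congr (phi _); rewrite /monomial3 -!mul_polyC; ring.
rewrite !(phiD, phiZ) !hphi // /deriv_monomial /=.
by rewrite /deriv_op !(expandE, proj2 hD, halphaD).
Qed.

Lemma deriv_op_opr a b c a' b' c' :
  deriv_op a b c (alpha x) (deriv_op a' b' c' y z)
  = phi ((a%:P * X + b%:P * (Y + Z) + c%:P) * (a'%:P * Y + b'%:P * Z + c'%:P)).
Proof.
transitivity (phi (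
    a *: (a' *: m 1 1 0 + b' *: m 1 0 1 + c' *: m 1 0 0)
    + b *: (a' *: (m 0 2 0 + m 0 1 1) + b' *: (m 0 1 1 + m 0 0 2)
            + c' *: (m 0 1 0 + m 0 0 1))
    + c *: (a' *: m 0 1 0 + b' *: m 0 0 1 + c' *: m 0 0 0))); last first.
  by congr (phi _); rewrite /monomial3 -!mul_polyC; ring.
rewrite !(phiD, phiZ) !hphi // /deriv_monomial /=.
(* Pulling [alpha] outside D exposes the shape alpha(u) (v w) that hom-associativity turns into a
   monomial. *)
by rewrite /deriv_op !(expandE, proj2 hD) -!halphaD /= !(hom_associativity hA).
Qed.

End Symbols.

Lemma deriv_hom_Lie : hom_Lie_superalgebra (deriv_op (-1) 1 0) alpha.
Proof.
split; [exact: deriv_op_even | exact: hom_assoc_alpha_even hA | |].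
- move=> i j x y hx hy; rewrite /deriv_op !scale0r !scale1r !scaleN1r !addr0.
  have hDx : D x \in homog A i by apply: (iter_homog 1).
  have hDy : D y \in homog A j by apply: (iter_homog 1).
  by rewrite (hcomm hDx hy) (hcomm hx hDy) scalerDr scalerN opprD opprK addrC.
move=> i j k x y z hx hy hz.
have [X [Y [Z [phi h]]]] := symbol_map_exists x y z.
(* Each cyclic shift is two swaps. The sign written in the axiom cancels one of the two swap signs,
   leaving [ksign K i k] common to all three terms. *)
have hyzx := symbol_map_swapr (symbol_map_swapl h hx hy) hx hz.
have hzxy := symbol_map_swapl (symbol_map_swapr h hy hz) hx hz.
rewrite (deriv_op_opl h) (deriv_op_opl hyzx) (deriv_op_opl hzxy) /= !ksignZK.
rewrite -!scalerDr -!raddfD /=.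
by rewrite [X in phi X](_ : _ = 0) ?raddf0 ?scaler0 //; ring.
Qed.

(** The associator has symbol -Z (Z + lambda), free of X and Y, hence left symmetry. Right
    commutativity is the symmetry of (Z + lambda) (Y + lambda) in Y and Z. *)
Lemma deriv_hom_Novikov lambda :
  hom_Novikov_superalgebra (deriv_op 0 1 lambda) alpha.
Proof.
split; [exact: deriv_op_even | exact: hom_assoc_alpha_even hA | |] => i j k x y z;
  move=> hx hy hz; have [X [Y [Z [phi h]]]] := symbol_map_exists x y z.
- have hyxz := symbol_map_swapl h hx hy.
  rewrite (deriv_op_opl h) (deriv_op_opr h).
  rewrite (deriv_op_opl hyxz) (deriv_op_opr hyxz) /=.
  rewrite -!scalerBr scalerA ksignK scale1r -!raddfB /=.
  by congr (phi _); ring.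
have hxzy := symbol_map_swapr h hy hz.
rewrite (deriv_op_opl h) (deriv_op_opl hxzy) /= scalerA ksignK scale1r.
by congr (phi _); ring.
Qed.

Lemma deriv_hom_Gelfand_Dorfman lambda :
  super_hom_Gelfand_Dorfman_bialgebra
    (deriv_bracket mul D) (deriv_circ mul D lambda) alpha.
Proof.
have -> : deriv_bracket mul D = deriv_op (-1) 1 0.
  by apply/funext => x; apply/funext => y; apply: deriv_bracketE.
have -> : deriv_circ mul D lambda = deriv_op 0 1 lambda.
  by apply/funext => x; apply/funext => y; apply: deriv_circE.
split; [exact: deriv_hom_Lie | exact: deriv_hom_Novikov |].
move=> i j k x y z hx hy hz.
have [X [Y [Z [phi h]]]] := symbol_map_exists x y z.
have hxzy := symbol_map_swapr h hy hz.
rewrite !(deriv_op_opl h) !(deriv_op_opl hxzy) (deriv_op_opr h) /=.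
rewrite !scalerA ksignK !scale1r -!(raddfD, raddfB) /=.
(* The terms with factor Y + lambda add up to -Y (Y + lambda), those with Z + lambda to Z (Z +
   lambda); together they give (Y + Z + lambda) (Z - Y), the symbol of the last term. *)
by rewrite [X in phi X](_ : _ = 0) ?raddf0 //; ring.
Qed.

End DerivationCalculus.

Theorem theorem3p10 (R : realType) (A : superspace R[i])
    (mul : A -> A -> A) (alpha D : A -> A) (lambda : R[i])
    (hA : hom_associative_superalgebra mul alpha)
    (hcomm : supercommutative mul)
    (hD : even_derivation mul D)
    (halphaD : forall x : A, alpha (D x) = D (alpha x)) :
  super_hom_Gelfand_Dorfman_bialgebra
    (deriv_bracket mul D) (deriv_circ mul D lambda) alpha.
Proof. exact: deriv_hom_Gelfand_Dorfman. Qed.
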